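(* Let $p$ be a prime, $q=p^{n}$, and $F=\mathrm{GF}(q)=\{a_{0}=0,a_{1},\dots,a_{q-1}\}$. For $c\in F$ let $f_{c}:F\to F$, $f_{c}(x)=cx$, and let $M(f_{c})$ be the $q\times q$ matrix over $F$, with rows and columns indexed by the elements of $F$, whose $(a,b)$ entry is $f_{c}(b-a)$. Let $H_{q}$ be the $q^{2}\times q^{2}$ block matrix $H_{q}=[H_{i,m}]_{0\le i,m\le q-1}$ whose $(i,m)$ block is $H_{i,m}=M(f_{a_{i}+a_{m}})$. Then $H_{q}$ is a $\mathrm{GH}(q,q)$ over the additive group of $F$.
   Context: For a finite additive abelian group $U$ of order $u$ and a positive integer $\lambda$, a generalized Hadamard matrix $\mathrm{GH}(u,\lambda)$ over $U$ is a square matrix $[d_{ij}]$ of order $u\lambda$ with entries in $U$ such that for any two distinct rows $i\neq \ell$, the multiset $\{d_{ij}-d_{\ell j}: 1\le j\le u\lambda\}$ contains each element of $U$ exactly $\lambda$ times. *)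

(* Defs.v *)
From HB Require Import structures.
From mathcomp Require Import all_boot all_order all_algebra all_field.
Set Implicit Arguments. Unset Strict Implicit. Unset Printing Implicit Defensive.
Import GRing.Theory.
Local Open Scope ring_scope.

(* The order N is a separate index, constrained to be u * lambda, so that block
   matrices (whose dimensions are sums of block sizes) can be used without casts. *)
Definition is_GH (U : finZmodType) (u lambda N : nat) (D : 'M[U]_N) : Prop :=
  [/\ #|U| = u, (0 < lambda)%N, N = (u * lambda)%N
    & forall i l : 'I_N, i != l ->
      forall x : U, #|[set j : 'I_N | D i j - D l j == x]| = lambda].

Definition fmul (F : finFieldType) (c : F) : F -> F := fun x => c * x.

(* The element a i of F labels row i and column i. *)
Definition Mmx (F : finFieldType) (q : nat) (a : 'I_q -> F) (f : F -> F) :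
  'M[F]_q := \matrix_(r < q, s < q) f (a s - a r).

Definition Hmx (F : finFieldType) (q : nat) (a : 'I_q -> F) :
  'M[F]_(\sum_(i < q) q) :=
  \mxblock_(i < q, m < q) Mmx a (fmul (a i + a m)).

(* Main.v *)
Require Import Defs.
From HB Require Import structures.
From mathcomp Require Import all_boot all_order all_algebra all_field.
From mathcomp Require Import ring.
Import GRing.Theory.
Local Open Scope ring_scope.

(* The difference of row [r] of block row [i] and row [t] of block row [l], at
   column [s] of block column [m], is
     (a i - a l) * a s + (a t - a r) * a m + const,
   and distinct rows make this affine form in [(a s, a m)] nonconstant, so it
   takes every value of [F] on exactly [q] of the [q^2] points of [F * F]. *)

Lemma card_affine_line (F : finFieldType) (u v c : F) :
  (u != 0) || (v != 0) ->
  #|[set w : F * F | u * w.1 + v * w.2 == c]| = #|F|.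
Proof.
(* The line is the image of an injection from [F]: [w.2] is the free parameter when [v = 0],
   otherwise [w.1], the other coordinate being solved for. *)
case: (eqVneq v 0) => [-> | v0 _] /=.
  rewrite orbF => u0.
  have injg : injective (fun z : F => (u^-1 * c, z)) by move=> x y [].
  rewrite -(card_imset predT injg); apply: eq_card => -[y z].
  rewrite inE /= mul0r addr0; apply/eqP/imsetP => [<- | [x _ [-> _]]].
    by exists z; rewrite // mulKf.
  by rewrite mulVKf.
have injg : injective (fun y : F => (y, v^-1 * (c - u * y))) by move=> x y [].
rewrite -(card_imset predT injg); apply: eq_card => -[y z].
rewrite inE /=; apply/eqP/imsetP => [<- | [x _ [-> ->]]].
  by exists y; rewrite // addrC addKr mulKf.
by rewrite mulVKf // addrC subrK.
Qed.

Theorem theorem3p2 (p n q : nat) (F : finFieldType) (a : 'I_q -> F)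
  (hp : prime p) (hq : q = (p ^ n)%N) (hF : #|F| = q)
  (ha : bijective a) (ha0 : forall i : 'I_q, val i = 0%N -> a i = 0) :
  @is_GH F q q (\sum_(i < q) q)%N (@Hmx F q a).
Proof.
have q_gt0 : (0 < q)%N by rewrite hq expn_gt0 prime_gt0.
split=> //; first by rewrite sum_nat_const card_ord.
move=> i l neq_il x.
case: (ha) => b ab ba.
have a_inj := can_inj ab.
pose pt (j : 'I_(\sum_(i < q) q)) : F * F :=
  (a (tagnat.sig2 j), a (tagnat.sig1 j)).
have pt_bij : bijective pt.
  exists (fun w => tagnat.Rank (b w.2) (b w.1)) => [j | [y z]].
    by rewrite /pt /= !ab tagnat.sig2K.
  (* All blocks have size [q], so the cast between column types is the identity. *)
  rewrite /pt /= tagnat.Rank1K tagnat.Rank2K ba.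
  by rewrite cast_ord_id ba.
set i1 := tagnat.sig1 i; set i2 := tagnat.sig2 i : 'I_q.
set l1 := tagnat.sig1 l; set l2 := tagnat.sig2 l : 'I_q.
(* The products [a s * a m] cancel in the difference of entries; [k] is what does not depend on the
   column. *)
pose k := a l1 * a l2 - a i1 * a i2.
have entryE j : (Hmx a i j - Hmx a l j == x) =
    ((a i1 - a l1) * (pt j).1 + (a l2 - a i2) * (pt j).2 == x - k).
  rewrite /Hmx !mxE /fmul /= -/i1 -/i2 -/l1 -/l2.
  rewrite [RHS]eq_sym [RHS]subr_eq [RHS]eq_sym.
  by congr (_ == _); rewrite /k; ring.
have -> : [set j | Hmx a i j - Hmx a l j == x] = pt @^-1:
    [set w | (a i1 - a l1) * w.1 + (a l2 - a i2) * w.2 == x - k].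
  by apply/setP => j; rewrite !inE entryE.
rewrite on_card_preimset ?card_affine_line //; last exact: onW_bij.
(* If both coefficients vanish, [i] and [l] have the same image under [pt], since rows and columns
   share one index type. *)
rewrite !subr_eq0 !(inj_eq a_inj) -negb_and [l2 == _]eq_sym.
apply: contra neq_il => /andP[/eqP e1 /eqP e2].
by apply/eqP/(bij_inj pt_bij); rewrite /pt -/i1 -/i2 -/l1 -/l2 e1 e2.
Qed.
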